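(* For any small enough constant $\delta > 0$, there exists a family of bipartite $(r,t)$-Ruzsa-Szemer\'{e}di graphs $G=(A,B,E)$ with $|A| = |B| = N$, $r = (\frac{1}{2} - \delta) \cdot N$, and $t = N^{\Omega(\frac{1}{\log \log N})}$, such that there are $N^{\Omega(\frac{1}{\log \log N})}$ disjoint near-perfect matchings in $G$, each of size exactly $(1 - 2\delta) \cdot N$.
   Context: A matching $M$ in a graph $G$ is an induced matching if the edge set of the subgraph of $G$ induced by the vertices covered by $M$ is exactly $M$. A bipartite graph $G=(A,B,E)$ is an $(r,t)$-Ruzsa-Szemer\'{e}di graph if $E$ can be partitioned into $t$ disjoint matchings $M_1,\dots,M_t$ such that for every $i$, $|M_i|\ge r$ and $M_i$ is an induced matching in $G$.
   Formalization: For irrational δ the number (1−2δ)N is never an integer, so the near-perfect matchings are taken of size exactly ⌊(1−2δ)N⌋; for rational δ the family uses N with (1/2−δ)N an integer, so the size is exactly (1−2δ)N. *)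

(* Defs.v *)
From mathcomp Require Export all_boot all_order all_algebra.
From mathcomp Require Export reals exp.

Set Implicit Arguments.
Unset Strict Implicit.
Unset Printing Implicit Defensive.

Import Order.TTheory GRing.Theory Num.Theory.
Local Open Scope ring_scope.

(* A bipartite graph G = (A, B, E) is given by two finite types A, B and an
   edge set E : {set A * B}; the two sides are disjoint by construction. *)

Definition is_matching (A B : finType) (M : {set A * B}) : Prop :=
  forall e f, e \in M -> f \in M -> e.1 = f.1 \/ e.2 = f.2 -> e = f.

Definition matching_in (A B : finType) (E M : {set A * B}) : Prop :=
  M \subset E /\ is_matching M.

(* Edges of the subgraph of (A, B, E) induced by the vertices S in A, T in B. *)
Definition induced_edges (A B : finType) (E : {set A * B})
    (S : {set A}) (T : {set B}) : {set A * B} :=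
  [set e in E | (e.1 \in S) && (e.2 \in T)].

Definition induced_matching (A B : finType) (E M : {set A * B}) : Prop :=
  matching_in E M /\
  induced_edges E [set e.1 | e in M] [set e.2 | e in M] = M.

Definition pairwise_disjoint (T : finType) (k : nat) (M : 'I_k -> {set T}) :
    Prop :=
  forall i j : 'I_k, i != j -> [disjoint M i & M j].

Definition ruzsa_szemeredi (R : realType) (A B : finType) (E : {set A * B})
    (r : R) (t : nat) : Prop :=
  exists M : 'I_t -> {set A * B},
    [/\ \bigcup_(i < t) M i = E,
        pairwise_disjoint M
      & forall i, r <= #|M i|%:R /\ induced_matching E (M i)].

(* N ^ (c / log log N); a quantity q is N^{Omega(1 / log log N)} when
   loglog_pow c N <= q for some c > 0 independent of N. Only meaningful for
   N >= 3, where ln (ln N) > 0. *)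
Definition loglog_pow (R : realType) (c : R) (N : nat) : R :=
  N%:R `^ (c / ln (ln N%:R)).

(* Main.v *)
(* Work over Z_q with q = 2k, and let the vertices on both sides be the k x L
   matrices over Z_q, with L constant.  A code C of words f : [k] -> [L], any
   two of which agree in at most w ~ 2 delta k places, has size at least 2^k by
   Gilbert-Varshamov.  For f in C let u_f x be the sum of the entries of x on
   the graph of f and let v_f be the indicator matrix of that graph, so that
   u_f v_f = k = q / 2 while u_f v_g is in [0, w] for g <> f.  The edges x -> x + v_f
   with u_f x in [0, k - w), resp. [k, 2k - w), form matchings between these two
   strips of residues; an edge x -> x + v_g with g <> f moves u_f by at most w,
   hence cannot cross from one strip to the other, so the matchings are
   induced.  The two matchings of f together form a near-perfect matching.
   Here N = (2k)^(kL), so 2^k = N^{Omega(1 / log log N)}. *)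
Require Import Defs.
From mathcomp Require Import zify ring lra.

Set Implicit Arguments.
Unset Strict Implicit.
Unset Printing Implicit Defensive.

Import Order.TTheory GRing.Theory Num.Theory.
Local Open Scope ring_scope.

(** * Codes whose words agree pairwise in few places *)

Definition agree (k L : nat) (f g : {ffun 'I_k -> 'I_L}) : {set 'I_k} :=
  [set i | f i == g i].

Definition is_code (k L w : nat) (C : {set {ffun 'I_k -> 'I_L}}) : bool :=
  [forall f in C, forall g in C, (f != g) ==> (#|agree f g| <= w)%N].

(** Such a word has one choice at each place of [S] and [L] choices at every other place. *)
Lemma card_agree_on (k L : nat) (f : {ffun 'I_k -> 'I_L}) (S : {set 'I_k}) :
  (#|[set g | S \subset agree f g]| = L ^ (k - #|S|))%N.
Proof.
pose F (i : 'I_k) : pred 'I_L := if i \in S then pred1 (f i) else predT.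
have -> : (k - #|S| = #|~: S|)%N by rewrite [RHS]cardsCs setCK card_ord.
have -> : #|[set g | S \subset agree f g]| = #|family F|.
  apply: eq_card => g; rewrite inE; apply/subsetP/familyP => [sub i|fam i iS].
    rewrite unfold_in /F; case: ifP => // iS.
    by have := sub i iS; rewrite inE eq_sym.
  have gi : F i (g i) by exact: fam i.
  by move: gi; rewrite inE /F iS eq_sym.
rewrite card_family foldrE big_image /= (bigID (mem S)) /=.
rewrite big1 => [|i iS]; last by rewrite /F iS card1.
rewrite mul1n (eq_bigr (fun=> L)) => [|i /negbTE iS]; last first.
  by rewrite /F iS card_ord.
by rewrite prod_nat_const; congr expn; apply: eq_card => i; rewrite !inE.
Qed.

Lemma leq_card_bigcup (I T : finType) (P : pred I) (F : I -> {set T}) :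
  (#|\bigcup_(i | P i) F i| <= \sum_(i | P i) #|F i|)%N.
Proof.
elim/big_rec2: _ => [|i m S _ le_m]; first by rewrite cards0.
by rewrite cardsU (leq_trans (leq_subr _ _)) // leq_add2l.
Qed.

(** Union bound over the at most [2 ^ k] sets [S] of more than [w] places on which a word can agree
    with [f]. *)
Lemma card_agree_ball (k L w : nat) (f : {ffun 'I_k -> 'I_L}) : (w < k)%N ->
  (#|[set g | (w < #|agree f g|)%N]| <= 2 ^ k * L ^ (k - w.+1))%N.
Proof.
move=> ltwk.
(* Monotonicity in the exponent needs a positive base; over an empty alphabet there is no word [f],
   since [k > 0]. *)
case: L f => [|L] f; first by case: (f (Ordinal ltwk)).
have sub : [set g | (w < #|agree f g|)%N] \subset
    \bigcup_(S in [set S : {set 'I_k} | (w < #|S|)%N])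
      [set g | S \subset agree f g].
  apply/subsetP=> g; rewrite inE => gw.
  by apply/bigcupP; exists (agree f g); rewrite inE.
apply: leq_trans (subset_leq_card sub) _.
apply: leq_trans (leq_card_bigcup _ _) _.
apply: (@leq_trans (\sum_(S in [set S : {set 'I_k} | (w < #|S|)%N])
    L.+1 ^ (k - w.+1))%N).
  apply: leq_sum => S; rewrite inE => wS.
  by rewrite card_agree_on leq_pexp2l // leq_sub2l.
rewrite sum_nat_const leq_mul2r; apply/orP; right.
have -> : (2 ^ k = #|powerset [set: 'I_k]|)%N.
  by rewrite card_powerset cardsT card_ord.
by apply: subset_leq_card; rewrite powersetT subsetT.
Qed.

(* Gilbert-Varshamov: the balls around a maximal code cover all words. *)
Lemma gilbert_varshamov (k L w : nat) : (w < k)%N ->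
  exists2 C : {set {ffun 'I_k -> 'I_L}}, is_code w C
    & (L ^ k <= #|C| * (2 ^ k * L ^ (k - w.+1)))%N.
Proof.
move=> ltwk.
have code0 : is_code w (set0 : {set {ffun 'I_k -> 'I_L}}).
  by apply/forall_inP => f; rewrite inE.
pose C := [arg max_(D > (set0 : {set {ffun 'I_k -> 'I_L}}) | is_code w D) #|D|].
have [codeC maxC] : is_code w C /\
    forall D : {set {ffun 'I_k -> 'I_L}}, is_code w D -> (#|D| <= #|C|)%N.
  by rewrite /C; case: arg_maxnP.
exists C => //.
have cover : [set: {ffun 'I_k -> 'I_L}] \subset
    \bigcup_(f in C) [set g | (w < #|agree f g|)%N].
  apply/subsetP => g _; apply/bigcupP.
  case: (boolP (g \in C)) => gC.
    exists g; rewrite // inE /agree.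
    by rewrite (eq_card (B := 'I_k)) ?card_ord // => i; rewrite !inE eqxx.
  case: (boolP [exists f in C, (w < #|agree f g|)%N]) => [|none].
    by move=> /exists_inP[f fC fg]; exists f; rewrite // inE.
  have far f : f \in C -> (#|agree f g| <= w)%N.
    move=> fC; rewrite leqNgt; apply: contra none => fg.
    by apply/exists_inP; exists f.
  (* An uncovered [g] could be added to [C], against maximality. *)
  suff /maxC : is_code w (g |: C) by rewrite cardsU1 gC ltnn.
  apply/forall_inP => f1 f1C; apply/forall_inP => f2 f2C; apply/implyP => f12.
  have agreeC : agree f1 f2 = agree f2 f1.
    by apply/setP => i; rewrite !inE eq_sym.
  move: f1C f2C; rewrite !inE => /predU1P[e1|f1C] /predU1P[e2|f2C].
  - by rewrite e1 e2 eqxx in f12.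
  - by rewrite agreeC e1 far.
  - by rewrite e2 far.
  - by have /forall_inP/(_ _ f1C)/forall_inP/(_ _ f2C)/implyP := codeC; apply.
have := subset_leq_card cover; rewrite cardsT card_ffun !card_ord => le1.
apply: leq_trans le1 (leq_trans (leq_card_bigcup _ _) _).
by rewrite -sum_nat_const; apply: leq_sum => f _; apply: card_agree_ball.
Qed.

(** Over [4 ^ p] letters the saving [L ^ w.+1] is at least [4 ^ k], which beats the [2 ^ k] of the
    union bound by another [2 ^ k]. *)
Lemma exponential_code (k p w : nat) : (w < k)%N -> (k <= p * w.+1)%N ->
  exists2 C : {set {ffun 'I_k -> 'I_(4 ^ p)}}, is_code w C & (2 ^ k <= #|C|)%N.
Proof.
move=> ltwk le_k; have [C codeC leC] := @gilbert_varshamov k (4 ^ p) w ltwk.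
exists C => //.
move: leC; rewrite -{1}(subnKC ltwk) expnD mulnA leq_pmul2r; last first.
  by rewrite !expn_gt0.
rewrite -expnM => leC.
rewrite -(@leq_pmul2r (2 ^ k)%N) ?expn_gt0 // -expnMn.
by apply: leq_trans leC; rewrite leq_pexp2l.
Qed.

(** * Induced matchings from shifts in an abstract finite abelian group *)

Section ShiftMatchings.

Variables (V : finZmodType) (n k w : nat) (I : finType).
Variables (u : I -> V -> 'I_n.+2) (v : I -> V).

(** The strips of residues. Each is followed by a gap of [w] residues, which absorbs any shift by at
    most [w]. *)
Definition half (b : bool) : pred 'I_n.+2 :=
  fun z => (b * k <= z < b * k + (k - w))%N.

Definition shift_matching (p : I * bool) : {set V * V} :=
  [set e | (e.2 == e.1 + v p.1) && half p.2 (u p.1 e.1)].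

Hypothesis nE : n.+2 = (k + k)%N.
Hypothesis uD : forall i, {morph u i : x y / x + y}.
Hypothesis uv_eq : forall i, u i (v i) = k :> nat.
Hypothesis uv_neq : forall i j, i != j -> (u i (v j) <= w)%N.
Hypothesis u_onto : forall i, exists e, u i e = 1.
Hypothesis lt_wk : (w < k)%N.

Lemma uD_val i x y : u i (x + y) = ((u i x + u i y) %% (k + k))%N :> nat.
Proof. by rewrite uD -nE. Qed.

Lemma u_lt i x : (u i x < k + k)%N.
Proof. by rewrite -nE. Qed.

Lemma v_inj : injective v.
Proof.
move=> i j eq_v; apply/eqP/negPn/negP => /uv_neq.
by rewrite -eq_v uv_eq leqNgt lt_wk.
Qed.

Lemma half_shift i b x : half b (u i x) -> half (~~ b) (u i (x + v i)).
Proof.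
rewrite /half uD_val uv_eq; have := u_lt i x.
case: b => /= ltx hx.
  have -> : (u i x + k = (u i x - k) + (k + k))%N by lia.
  by rewrite modnDr modn_small; lia.
by rewrite modn_small; lia.
Qed.

(** The shifted value stays in the strip or the gap above it, so it is below [2k] and does not wrap
    around. *)
Lemma half_no_cross i j b x : j != i -> half b (u i x) ->
  ~~ half (~~ b) (u i (x + v j)).
Proof.
rewrite eq_sym /half uD_val => /uv_neq; have := u_lt i x.
by case: b => /= ltx le_w hx; rewrite modn_small; lia.
Qed.

Lemma half_disjoint z : half true z -> ~~ half false z.
Proof. by rewrite /half /=; lia. Qed.

(** An edge determines its shift and hence its index by [v_inj]; for a single index the two strips
    are disjoint. *)
Lemma shift_matching_disjoint p q : p != q ->
  [disjoint shift_matching p & shift_matching q].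
Proof.
case: p q => [i b] [j c] neq; rewrite disjoint_subset; apply/subsetP => -[x y].
rewrite !inE /= => /andP[/eqP-> hb]; apply/negP => /andP[/eqP/addrI/v_inj eij].
move: neq hb; rewrite -eij xpair_eqE eqxx /=.
case: b c => [] [] //= _.
  by move=> /half_disjoint/negbTE->.
by move=> hf /half_disjoint; rewrite hf.
Qed.

Definition shift_graph : {set V * V} := \bigcup_p shift_matching p.

Lemma is_matching_shift i :
  is_matching (shift_matching (i, false) :|: shift_matching (i, true)).
Proof.
have shiftE e : e \in shift_matching (i, false) :|: shift_matching (i, true) ->
    e.2 = e.1 + v i.
  by rewrite !inE /= => /orP[] /andP[/eqP].
move=> [x y] [x' y'] /shiftE/= -> /shiftE/= -> [->|/addIr ->] //.
Qed.

Lemma shift_matching_induced p :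
  induced_matching shift_graph (shift_matching p).
Proof.
have sub : shift_matching p \subset shift_graph by apply: bigcup_sup.
split; first split=> //.
  case: p {sub} => i b e f ep fp; apply: (@is_matching_shift i).
    by rewrite inE; case: b ep fp => -> // _; rewrite orbT.
  by rewrite inE; case: b ep fp => _ ->; rewrite // orbT.
apply/setP => -[x y]; rewrite inE; apply/idP/idP; last first.
  move=> xyp; rewrite (subsetP sub) //=; apply/andP.
  by split; apply/imsetP; exists (x, y).
case/and3P => /bigcupP[[j c] _ xyj] /imsetP[[x1 y1] xy1 /= ex].
move=> /imsetP[[x2 y2] xy2 /= ey]; case: p sub xy1 xy2 => i b _.
move: xyj; rewrite !inE /= -ex -ey.
move=> /andP[/eqP eyj _] /andP[_ hx] /andP[/eqP ey2 /half_shift].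
(* In terms of [u i], the edge goes from strip [b] to strip [~~ b]. This excludes [j != i], and for
   [j = i] the edge is in the matching. *)
rewrite -ey2 hx andbT; case: (eqVneq j i) => [<- _|ji]; first by rewrite eyj.
by rewrite eyj (negbTE (half_no_cross ji hx)).
Qed.

(** If [u i e = 1], translation by [e *+ z] carries the fiber over 0 onto the fiber over [z]. *)
Lemma card_fiber i z : #|[set x | u i x == z]| = #|[set x | u i x == 0]|.
Proof.
have [e ue] := u_onto i.
have uX x m : u i (x + e *+ m) = u i x + m%:R.
  elim: m => [|m IH]; first by rewrite !addr0.
  by rewrite mulrSr addrA uD IH ue mulrSr addrA.
rewrite -[RHS](card_imset _ (@addIr V (e *+ z))); apply: eq_card => x.
rewrite inE; apply/eqP/imsetP => [ux|[y]]; last first.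
  by rewrite inE => /eqP uy ->; rewrite uX uy add0r natr_Zp.
exists (x - e *+ z); last by rewrite subrK.
by rewrite inE -(inj_eq (@addIr _ z%:R)) -uX subrK ux natr_Zp add0r.
Qed.

Lemma card_preim_u i (P : pred 'I_n.+2) :
  #|[set x | P (u i x)]| = (#|P| * #|[set x | u i x == 0%R]|)%N.
Proof.
rewrite -sum1_card (partition_big (u i) P) => [|x]; last by rewrite inE.
rewrite -sum_nat_const; apply: eq_bigr => z Pz.
rewrite -(card_fiber i z) -sum1_card; apply: eq_bigl => x.
by rewrite !inE; case: eqP => [->|]; rewrite ?andbF ?andbT.
Qed.

Lemma card_half b : #|half b| = (k - w)%N.
Proof.
have lt_z (m : 'I_(k - w)) : (b * k + m < n.+2)%N.
  by have := ltn_ord m; rewrite nE; case: b; lia.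
have inj_z : injective (fun m : 'I_(k - w) => Ordinal (lt_z m)).
  by move=> m1 m2 [] /addnI /val_inj.
rewrite -[RHS]card_ord -(card_codom inj_z); apply: eq_card => z.
apply/idP/codomP => [|[m ->]]; last first.
  by rewrite unfold_in /half /= leq_addr ltn_add2l ltn_ord.
rewrite unfold_in /half => /andP[le_z lt_z'].
have lt_m : (z - b * k < k - w)%N by rewrite ltn_subLR.
by exists (Ordinal lt_m); apply: val_inj; rewrite /= subnKC.
Qed.

(** The edges correspond to the [x] with [u i x] in a strip of [k - w] out of [2k] residues, and all
    fibers of [u i] have the same size. *)
Lemma card_shift_matching p :
  (#|shift_matching p| * (k + k) = (k - w) * #|V|)%N.
Proof.
case: p => i b.
have inj_graph : injective (fun x : V => (x, x + v i)) by move=> x y [].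
have -> : #|shift_matching (i, b)| = #|[set x | half b (u i x)]|.
  rewrite -(card_imset _ inj_graph); apply: eq_card => -[x y].
  rewrite inE /=; apply/andP/imsetP => [[/eqP-> hx]|[x']].
    by exists x; rewrite // inE.
  by rewrite inE => hx [-> ->].
have -> : #|V| = #|[set x | predT (u i x)]| by apply: eq_card => x; rewrite inE.
by rewrite -nE !card_preim_u card_half card_ord -mulnA [X in (_ * X)%N]mulnC.
Qed.

Lemma card_shift_pair i :
  (#|shift_matching (i, false) :|: shift_matching (i, true)| * k =
   (k - w) * #|V|)%N.
Proof.
have /shift_matching_disjoint dis : (i, false) != (i, true).
  by rewrite xpair_eqE eqxx.
rewrite cardsU disjoint_setI0 // cards0 subn0.
have := card_shift_matching (i, false); have := card_shift_matching (i, true).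
lia.
Qed.

Lemma shift_graph_ruzsa_szemeredi (R : realType) (r : R) :
  r <= ((k - w)%:R / (k + k)%:R) * #|V|%:R ->
  ruzsa_szemeredi shift_graph r (#|I| + #|I|).
Proof.
move=> le_r.
have cardT : #|{: I * bool}| = (#|I| + #|I|)%N.
  by rewrite card_prod card_bool muln2 addnn.
rewrite -cardT; exists (fun m => shift_matching (enum_val m)).
split=> [|m1 m2 neq|m].
- rewrite /shift_graph; apply/setP => e.
  apply/bigcupP/bigcupP => [[m _ em]|[p _ ep]]; first by exists (enum_val m).
  by exists (enum_rank p); rewrite // enum_rankK.
- by apply: shift_matching_disjoint; rewrite (inj_eq enum_val_inj).
split; last exact: shift_matching_induced.
apply: le_trans le_r _; rewrite mulrAC -natrM -(card_shift_matching (enum_val m)) natrM.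
by rewrite mulfK // pnatr_eq0; lia.
Qed.

Lemma shift_graph_near_perfect (s : nat) :
    (s * k <= (k - w) * #|V|)%N ->
  exists P : 'I_#|I| -> {set V * V},
    pairwise_disjoint P /\ forall j, matching_in shift_graph (P j) /\ #|P j| = s.
Proof.
move=> le_s.
pose U i := shift_matching (i, false) :|: shift_matching (i, true).
(* The two matchings of one index form a single matching, cut down here to its first [s] edges. *)
pose P (m : 'I_#|I|) := [set e in take s (enum (U (enum_val m)))].
have PU m : P m \subset U (enum_val m).
  by apply/subsetP => e; rewrite inE => /mem_take; rewrite mem_enum.
exists P; split=> [m1 m2 neq|m].
  apply: disjointWl (PU m1) (disjointWr (PU m2) _).
  have dis b c : [disjoint shift_matching (enum_val m1, b)
                         & shift_matching (enum_val m2, c)].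
    apply: shift_matching_disjoint.
    by rewrite xpair_eqE (inj_eq enum_val_inj) (negbTE neq).
  by rewrite -setI_eq0 setIUl !setIUr !disjoint_setI0 ?setU0.
split; first split.
- apply: subset_trans (PU m) _; rewrite subUset.
  by apply/andP; split; apply: bigcup_sup.
- move=> e f /(subsetP (PU m)) eU /(subsetP (PU m)) fU.
  exact: is_matching_shift eU fU.
rewrite cardsE (card_uniqP (take_uniq _ (enum_uniq _))) size_takel // -cardE.
rewrite -(@leq_pmul2r k); last by lia.
by rewrite card_shift_pair.
Qed.

End ShiftMatchings.

(** * Sums and shifts of matrices along the graphs of codewords *)

Section CodeShifts.

Variables (k L w n : nat) (C : {set {ffun 'I_k -> 'I_L}}).
Hypothesis nE : n.+2 = (k + k)%N.
Hypothesis lt_wk : (w < k)%N.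
Hypothesis codeC : is_code w C.

Definition code_sum (f : {f | f \in C}) (x : 'M['I_n.+2]_(k, L)) : 'I_n.+2 :=
  \sum_i x i (val f i).

Definition code_shift (f : {f | f \in C}) : 'M['I_n.+2]_(k, L) :=
  \matrix_(i, j) (val f i == j)%:R.

Lemma code_sumD f : {morph code_sum f : x y / x + y}.
Proof.
by move=> x y; rewrite /code_sum -big_split; apply: eq_bigr => i _; rewrite mxE.
Qed.

(** The sum has a 1 for each place of agreement; their number is at most [k < 2k], so reduction
    modulo [2k] does not change it. *)
Lemma code_sum_shift f g :
  code_sum f (code_shift g) = #|agree (val g) (val f)| :> nat.
Proof.
have -> : code_sum f (code_shift g) = #|agree (val g) (val f)|%:R.
  rewrite -sum1_card natr_sum /code_sum [RHS]big_mkcond; apply: eq_bigr => i _.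
  by rewrite mxE inE; case: eqP.
rewrite Zp_nat /= modn_small // nE.
have := max_card (agree (val g) (val f)); rewrite card_ord.
by move=> /leq_ltn_trans; apply; rewrite -addn1 leq_add2l (leq_trans _ lt_wk).
Qed.

Lemma code_sum_shift_eq f : code_sum f (code_shift f) = k :> nat.
Proof.
rewrite code_sum_shift (eq_card (B := 'I_k)) ?card_ord // => i.
by rewrite !inE eqxx.
Qed.

Lemma code_sum_shift_neq f g : f != g -> (code_sum f (code_shift g) <= w)%N.
Proof.
move=> neq; rewrite code_sum_shift.
have /forall_inP/(_ _ (valP g))/forall_inP/(_ _ (valP f))/implyP := codeC.
by apply; rewrite (inj_eq val_inj) eq_sym.
Qed.

Lemma code_sum_onto f : exists e, code_sum f e = 1.
Proof.
pose i0 : 'I_k := Ordinal (leq_trans (ltn0Sn w) lt_wk).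
exists (delta_mx i0 (val f i0)); rewrite /code_sum (bigD1 i0) //= mxE !eqxx.
by rewrite big1 ?addr0 // => i /negbTE ne; rewrite mxE ne.
Qed.

End CodeShifts.

(** * Growth of the code in terms of [N], and integrality of the matching sizes *)

Lemma loglog_pow_le_exp (R : realType) (k L : nat) : (0 < k)%N -> (4 <= L)%N ->
  loglog_pow (ln 2 / L%:R : R) ((k + k) ^ (k * L)) <= (2 ^ k)%:R.
Proof.
move=> k0 L4.
have q0 : (0 : R) < (k + k)%:R by rewrite ltr0n; lia.
have lnq : 2^-1 <= ln ((k + k)%:R : R).
  (* Apply [ln x <= x - 1] at [x = 1 / (2k) <= 1/2]. *)
  have iq0 : (0 : R) < (k + k)%:R^-1 by rewrite invr_gt0.
  have := @le_ln1Dx R ((k + k)%:R^-1 - 1).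
  rewrite [1 + _]addrC subrK lnV ?posrE // => /(_ ltac:(lra)) le_ln.
  have iq : ((k + k)%:R^-1 : R) <= 2^-1 by rewrite lef_pV2 ?posrE // ler_nat; lia.
  lra.
have lnN : ln (((k + k) ^ (k * L))%:R : R) = (k * L)%:R * ln (k + k)%:R.
  by rewrite natrX lnXn // mulr_natl.
have lnlnN : ln ((k + k)%:R : R) <= ln (ln (((k + k) ^ (k * L))%:R : R)).
  (* Here [L >= 4] enters: [k * L / 2 >= 2k]. *)
  have qN : ((k + k)%:R : R) <= (k * L)%:R * ln (k + k)%:R.
    apply: (@le_trans _ _ ((k * L)%:R * 2^-1)); last by rewrite ler_wpM2l.
    by rewrite ler_pdivlMr // -natrM ler_nat; nia.
  by rewrite lnN ler_ln ?posrE //; apply: lt_le_trans qN.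
have ln2 : (0 : R) <= ln 2 by rewrite ln_ge0 // ler1n.
have L0 : (0 : R) < L%:R by rewrite ltr0n; lia.
have -> : (2 ^ k)%:R = sequences.expR (ln 2 * k%:R) :> R.
  by rewrite natrX -[in LHS](@lnK R 2) ?posrE // -expRM_natr.
rewrite /loglog_pow /powR pnatr_eq0 expn_eq0 [(k + k == 0)%N]gtn_eqF /=; last lia.
rewrite ler_expR; move: lnlnN; set l := ln (ln _) => lnlnN; rewrite lnN.
have l0 : 0 < l by apply: lt_le_trans lnlnN; lra.
(* The last factor is at most 1 by [lnlnN], leaving the exponent [k ln 2] of [2 ^ k]. *)
have -> : ln 2 / L%:R / l * ((k * L)%:R * ln (k + k)%:R) =
    ln 2 * k%:R * (ln (k + k)%:R / l).
  by rewrite natrM; field; rewrite !gt_eqF.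
by rewrite -[leRHS]mulr1 ler_wpM2l ?mulr_ge0 // ler_pdivrMr ?mul1r.
Qed.

(** For rational [delta] its denominator serves as [d], and the extra factor 2 clears [2^-1]. For
    irrational [delta] the premise is false and [d = 1] will do. *)
Lemma rational_denominator (R : realType) (delta : R) : delta <= 2^-1 ->
  exists2 d : nat, (0 < d)%N &
    (exists q : rat, delta = ratr q) ->
    forall m : nat, (2^-1 - delta) * (d * 2 * m)%:R \is a Num.nat.
Proof.
move=> le_delta.
case: (boolp.pselect (exists q : rat, delta = ratr q)) => [[q qE]|noq]; last first.
  by exists 1%N.
have [dz dE] : exists m : nat, denq q = m.
  by exists (absz (denq q)); rewrite gez0_abs ?denq_ge0.
have d0 : (0 < dz)%N by rewrite -ltz_nat -dE denq_gt0.
exists dz => // _ m; have dR : (dz%:R : R) != 0 by rewrite pnatr_eq0 -lt0n.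
rewrite natrEint; apply/andP; split; last by rewrite mulr_ge0 // subr_ge0.
have -> : (2^-1 - delta) * (dz * 2 * m)%:R = ((dz%:Z - 2 * numq q) * m%:Z)%:~R.
  by rewrite qE /ratr dE intrM intrB intrM !natrM -!pmulrn; field.
exact: intr_int.
Qed.

(** * Choice of the parameters and assembly of the graph *)

Theorem theorem4 (R : realType) :
  exists2 delta0 : R, 0 < delta0 &
  forall delta : R, 0 < delta < delta0 ->
  exists2 c : R, 0 < c &
  forall N0 : nat, exists N : nat,
  [/\ (N0 <= N)%N, (3 <= N)%N,
      (* Every near-perfect matching below has size (1 - 2 delta) N rounded
         down; for rational delta no rounding takes place. *)
      (exists q : rat, delta = ratr q) ->
        (2^-1 - delta) * N%:R \is a Num.nat
    & exists (A B : finType) (E : {set A * B}) (t s : nat)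
        (P : 'I_s -> {set A * B}),
      [/\ #|A| = N /\ #|B| = N,
          ruzsa_szemeredi E ((2^-1 - delta) * N%:R) t,
          loglog_pow c N <= t%:R,
          loglog_pow c N <= s%:R
        & pairwise_disjoint P /\
          forall j, matching_in E (P j) /\
            #|P j| = Num.truncn ((1 - 2 * delta) * N%:R)]].
Proof.
exists 2^-1; first by rewrite invr_gt0.
move=> delta /andP[delta0 lt_delta].
have [d d0 dP] := rational_denominator (ltW lt_delta).
(* [p >= 1 / (2 delta)] gives [k <= p * w.+1] below; it depends on [delta] only, so [L] is
   constant. *)
have [p p0 le_p] : exists2 p : nat, (0 < p)%N & 1 <= p%:R * (2 * delta).
  exists (Num.truncn (2 * delta)^-1).+1 => //.
  have dd0 : 0 < 2 * delta by rewrite mulr_gt0.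
  by rewrite -ler_pdivrMr // div1r ltW // truncnS_gt.
pose L := (4 ^ p)%N.
have L4 : (4 <= L)%N by rewrite -[4%N]expn1 leq_pexp2l.
exists (ln 2 / L%:R).
  by rewrite divr_gt0 ?ln_gt0 ?ltr1n // ltr0n; lia.
(* The factor [d] serves integrality for rational [delta], and [N0.+2] makes [N] large. *)
move=> N0; pose k := (d * N0.+2)%N.
have k2 : (N0.+2 <= k)%N by rewrite /k leq_pmull.
pose n := (k + k).-2; have nE : n.+2 = (k + k)%N by rewrite /n; lia.
(* Rounding down gives [1 - w / k >= 1 - 2 delta] for the matching sizes, while [w.+1 > 2 delta k]
   keeps the code large. *)
pose w := Num.truncn (2 * delta * k%:R).
have kR : (0 : R) < k%:R by rewrite ltr0n; lia.
have dk0 : 0 <= 2 * delta * k%:R by rewrite !mulr_ge0 // ltW.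
have lt_wk : (w < k)%N.
  by rewrite /w truncn_lt_nat // gtr_pMl // mulrC -ltr_pdivlMr ?div1r.
have le_w : (w%:R : R) <= 2 * delta * k%:R by rewrite truncn_le.
have le_k : (k <= p * w.+1)%N.
  rewrite -(ler_nat R) natrM.
  apply: (@le_trans _ _ (p%:R * (2 * delta * k%:R))).
    by rewrite mulrA -[leLHS]mul1r ler_wpM2r // ltW.
  by rewrite ler_wpM2l // ltW // truncnS_gt.
have [C codeC leC] := exponential_code lt_wk le_k.
pose N := ((k + k) ^ (k * L))%N.
have leN : (k + k <= N)%N.
  rewrite /N -[leqLHS]expn1 leq_pexp2l //; last by rewrite muln_gt0; lia.
  by lia.
have cardV : #|{: 'M['I_n.+2]_(k, L)}| = N by rewrite card_mx card_ord nE.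
have wR : (k - w)%:R = k%:R - w%:R :> R by rewrite natrB // ltnW.
exists N; split; [by lia|by lia| |].
  move=> qP.
  (* One factor [2k = 2 * d * N0.+2] of the power already supplies the divisor [2d]. *)
  have -> : N = (d * 2 * (N0.+2 * (k + k) ^ (k * L).-1))%N.
    rewrite /N -{1}(@prednK (k * L)); last by rewrite muln_gt0; lia.
    rewrite expnS {1}addnn /k -mul2n; lia.
  exact: dP.
have uD := @code_sumD k L n C.
have uv_eq := @code_sum_shift_eq k L w n C nE lt_wk.
have uv_neq := @code_sum_shift_neq k L w n C nE lt_wk codeC.
have u_onto := @code_sum_onto k L w n C lt_wk.
pose s := Num.truncn ((1 - 2 * delta) * N%:R).
have le_s : (s * k <= (k - w) * #|{: 'M['I_n.+2]_(k, L)}|)%N.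
  rewrite cardV -(ler_nat R) natrM [leRHS]natrM wR.
  have le_s : (s%:R : R) <= (1 - 2 * delta) * N%:R.
    by rewrite truncn_le mulr_ge0 // subr_ge0; lra.
  apply: (@le_trans _ _ ((1 - 2 * delta) * N%:R * k%:R)).
    by rewrite ler_wpM2r // ltW.
  by rewrite mulrAC ler_wpM2r //; lra.
have [P [disP PP]] :=
  shift_graph_near_perfect nE uD uv_eq uv_neq u_onto lt_wk le_s.
have cardI : #|{: {f | f \in C}}| = #|C| by rewrite card_sig.
have le_pow : loglog_pow (ln 2 / L%:R : R) N <= #|C|%:R.
  apply: le_trans (loglog_pow_le_exp R _ L4) _; first by lia.
  by rewrite ler_nat.
exists _, _, (shift_graph k w (@code_sum k L n C) (@code_shift k L n C)).
exists (#|{: {f | f \in C}}| + #|{: {f | f \in C}}|)%N, #|{: {f | f \in C}}|, P.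
split=> //.
- apply: shift_graph_ruzsa_szemeredi => //.
  rewrite cardV ler_wpM2r // wR ler_pdivlMr ?ltr0n; last by lia.
  by rewrite natrD; lra.
- by rewrite cardI natrD (le_trans le_pow) // lerDl.
- by rewrite cardI.
Qed.
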